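(* Let $p\in[2,\infty)$ with $p\ne3$. For every simple and regular curve $\gamma\in X_p$ one has $\mathscr{M}_p(\gamma)>0$. Consequently, $\mathscr{M}_p$ has no stationary points: there is no simple and regular $\gamma\in X_p$ such that $\delta\mathscr{M}_p(\gamma,\Phi)=0$ for all $\Phi\in X_p$.
   Context: Functions on $\mathbb{R}/2\pi\mathbb{Z}$ are $2\pi$-periodic functions on $\mathbb{R}$. For $p>3$, $X_p:=W^{2-\frac2p,p}(\mathbb{R}/2\pi\mathbb{Z},\mathbb{R}^3)$, the space of all $\gamma\in W^{1,p}(\mathbb{R}/2\pi\mathbb{Z},\mathbb{R}^3)$ with $\int_0^{2\pi}\int_{-\pi}^{\pi}\frac{|\gamma'(x+w)-\gamma'(x)|^p}{|w|^{p-1}}\,dw\,dx<\infty$ (its elements are $C^1$); for $p\in[2,3)$, $X_p:=C^{1,\alpha}(\mathbb{R}/2\pi\mathbb{Z},\mathbb{R}^3)$ with any fixed $\alpha\in(1-\frac2p,1]$. A closed curve $\gamma$ is simple if $\gamma(s)\ne\gamma(t)$ whenever $s-t\notin2\pi\mathbb{Z}$; a $C^1$ curve is regular if $\gamma'$ never vanishes. For a simple, regular closed curve put $$c_\gamma(s,t,\sigma):=\frac{2\,|(\gamma(t)-\gamma(s))\wedge(\gamma(\sigma)-\gamma(s))|}{|\gamma(t)-\gamma(s)|\,|\gamma(s)-\gamma(\sigma)|\,|\gamma(\sigma)-\gamma(t)|}$$ (with $\wedge$ the cross product; defined off the null set where two arguments differ by an element of $2\pi\mathbb{Z}$) and $$\mathscr{M}_p(\gamma):=\int_0^{2\pi}\int_0^{2\pi}\int_0^{2\pi}c_\gamma(s,t,\sigma)^p\,|\gamma'(s)|\,|\gamma'(t)|\,|\gamma'(\sigma)|\,d\sigma\,dt\,ds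 .$$ The first variation is $\delta\mathscr{M}_p(\gamma,\Phi):=\frac{d}{d\tau}\big|_{\tau=0}\mathscr{M}_p(\gamma+\tau\Phi)$; it exists for all simple regular $\gamma\in X_p$ and all $\Phi\in X_p$. *)

(* Defs.v *)
From HB Require Import structures.
From mathcomp Require Import all_boot all_order all_algebra.
From mathcomp Require Import all_classical all_reals all_analysis.

Set Implicit Arguments.
Unset Strict Implicit.
Unset Printing Implicit Defensive.

Import Order.TTheory GRing.Theory Num.Theory.
Import numFieldNormedType.Exports.

Local Open Scope classical_set_scope.
Local Open Scope ring_scope.

Section Vectors.
Variable R : realType.
Implicit Types u v : 'rV[R]_3.

(* The library norm on matrices is the sup norm, hence this definition. *)
Definition enorm v : R := Num.sqrt (\sum_(i < 3) v 0 i ^+ 2).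

(* Indices are taken modulo 3. *)
Definition cross u v : 'rV[R]_3 :=
  \row_(i < 3) (u 0 (i + 1) * v 0 (i + 2) - u 0 (i + 2) * v 0 (i + 1)).

End Vectors.

Definition period (R : realType) : set R := `[0, 2 * pi].
Arguments period : clear implicits.

(* Functions on R/2piZ are 2pi-periodic functions on R. *)
Section Spaces.
Variable R : realType.
Implicit Types (f g : R -> 'rV[R]_3) (p alpha : R).

Local Notation mu := (@lebesgue_measure R).

Definition C1 f : Prop :=
  (forall x, derivable f x 1) /\ continuous (derive1 f).

Definition C1_holder alpha f : Prop :=
  [/\ periodic f (2 * pi), C1 f &
      exists C : R, forall x y,
        enorm (derive1 f x - derive1 f y) <= C * `|x - y| `^ alpha].

Definition Lp_circle p f : Prop :=
  [/\ periodic f (2 * pi),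
      forall i : 'I_3, measurable_fun setT (fun x => f x 0 i) &
      (\int[mu]_(x in period R) (enorm (f x) `^ p)%:E < +oo)%E].

Definition smooth_periodic (phi : R -> R) : Prop :=
  periodic phi (2 * pi) /\ forall n x, derivable (derive1n n phi) x 1.

Definition weak_derivative f g : Prop :=
  forall (phi : R -> R) (i : 'I_3), smooth_periodic phi ->
    (\int[mu]_(x in period R) (f x 0 i * derive1 phi x)%:E =
     - \int[mu]_(x in period R) (g x 0 i * phi x)%:E)%E.

(* The space W^{2-2/p,p}(R/2piZ,R^3), each class being represented by its
   continuous representative. The first three conjuncts under the
   existential say that f is in W^{1,p} with weak derivative g. *)
Definition sobolev_slobodeckij p f : Prop :=
  continuous f /\
  exists g : R -> 'rV[R]_3,
    [/\ Lp_circle p f, Lp_circle p g, weak_derivative f g &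
        (\int[mu]_(x in period R)
           \int[mu]_(w in `[(- pi)%R, pi%R])
             (enorm (g (x + w) - g x) `^ p / `|w| `^ (p - 1))%:E < +oo)%E].

(* The parameter alpha is only used when p < 3. *)
Definition curve_space p alpha f : Prop :=
  if p < 3 then C1_holder alpha f else sobolev_slobodeckij p f.

Definition simple_closed f : Prop :=
  forall s t, (forall k : int, s - t <> 2 * pi * k%:~R) -> f s <> f t.

Definition regular f : Prop := C1 f /\ forall x, derive1 f x <> 0.

End Spaces.

Section Energy.
Variable R : realType.
Implicit Types (f Phi : R -> 'rV[R]_3) (p : R).

Local Notation mu := (@lebesgue_measure R).

(* The junk value 0 where two of the points coincide only concerns a null set
   when f is simple. *)
Definition menger_curvature f (s t r : R) : R :=
  2 * enorm (cross (f t - f s) (f r - f s)) /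
  (enorm (f t - f s) * enorm (f s - f r) * enorm (f r - f t)).

Definition menger_energy p f : \bar R :=
  (\int[mu]_(s in period R)
     \int[mu]_(t in period R)
       \int[mu]_(r in period R)
         (menger_curvature f s t r `^ p
          * enorm (derive1 f s) * enorm (derive1 f t)
          * enorm (derive1 f r))%:E)%E.

(* The derivative at tau = 0 of the energy of f + tau Phi exists as a real
   number, which requires the energy to be finite near 0, and equals d. *)
Definition is_first_variation p f Phi (d : R) : Prop :=
  let E (tau : R) := menger_energy p (fun x => f x + tau *: Phi x) in
  (\forall tau \near (0 : R), E tau \is a fin_num) /\
  is_derive (0 : R) (1 : R) (fun tau => fine (E tau)) d.

End Energy.

(* Main.v *)
Require Import Defs.
From HB Require Import structures.
From mathcomp Require Import all_boot all_order all_algebra.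
From mathcomp Require Import all_classical all_reals all_analysis.
From mathcomp Require Import zify ring lra.

Set Implicit Arguments.
Unset Strict Implicit.
Unset Printing Implicit Defensive.

Import Order.TTheory GRing.Theory Num.Theory.
Import numFieldNormedType.Exports.

Local Open Scope classical_set_scope.
Local Open Scope ring_scope.

(** A simple closed curve is not contained in a line: on a line, all coordinates
would be functions of a single one, and a continuous periodic real function
takes the same value at two antipodal points. So three points of the curve are
not collinear, and by continuity the Menger integrand is bounded below by a
positive constant near the corresponding parameters; hence the energy is
positive. The energy scales as [M_p(k f) = k^(3-p) M_p(f)], so its first
variation at [f] in the direction [f] is [(3 - p) M_p(f)], which does not vanish
when [p <> 3]. *)

(* The integral of a nonnegative function is a supremum over simple functions,
   so that monotonicity and homogeneity require no measurability; this avoids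
   discussing the measurability of the partial integrals of the energy. *)
Section ge0_integral_nonmeasurable.
Context (d : measure_display) (T : measurableType d) (R : realType).
Variable mu : {measure set T -> \bar R}.
Implicit Types (A D : set T) (f g : T -> \bar R).
Local Open Scope ereal_scope.

Import HBNNSimple.

Lemma ge0_subset_le_integral A D f g : A `<=` D ->
  (forall x, A x -> 0 <= f x <= g x) -> (forall x, D x -> 0 <= g x) ->
  \int[mu]_(x in A) f x <= \int[mu]_(x in D) g x.
Proof.
move=> AD fg g0.
rewrite ge0_integralE => [|x /fg/andP[]//]; rewrite [leRHS]ge0_integralE//.
apply: ereal_sup_le => _ [h hf <-]; exists h => // x.
apply: (le_trans (hf x)); apply: (@le_trans _ _ ((g \_ A) x)).
  by apply: lee_restrict => y /fg/andP[].
exact: restrict_lee.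
Qed.

Lemma ge0_integral_ge_cst A D f (c : R) : measurable A -> A `<=` D ->
  (0 <= c)%R -> (forall x, A x -> c%:E <= f x) ->
  (forall x, D x -> 0 <= f x) ->
  c%:E * mu A <= \int[mu]_(x in D) f x.
Proof.
move=> mA AD c0 cf f0; rewrite -integral_cst//.
by apply: ge0_subset_le_integral => // x Ax; rewrite lee_fin c0 cf.
Qed.

Let nnsfun_below f := [set h : {nnsfun T >-> R} | forall x, (h x)%:E <= f x].

Let nnsfun_below_scale f (k : R) : (0 < k)%R ->
  [set sintegral mu h | h in nnsfun_below (fun x => k%:E * f x)] =
  [set k%:E * y | y in [set sintegral mu h | h in nnsfun_below f]].
Proof.
move=> k0; have ki0 : (0 <= k^-1)%R by rewrite invr_ge0 ltW.
apply/seteqP; split=> [_ [h hf <-]|_ [_ [h hf <-] <-]].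
- exists (k^-1%:E * sintegral mu h); last first.
    by rewrite muleA -EFinM divff ?gt_eqF// mul1e.
  exists (scale_nnsfun h ki0); last by rewrite -sintegralrM.
  by move=> x /=; rewrite EFinM -lee_pdivlMl ?invr_gt0// invrK.
- exists (scale_nnsfun h (ltW k0)); last by rewrite -sintegralrM.
  by move=> x /=; rewrite EFinM lee_pmul2l.
Qed.

Lemma ge0_integralZl_nonmeasurable D f (k : R) :
  (forall x, D x -> 0 <= f x) -> (0 < k)%R ->
  \int[mu]_(x in D) (k%:E * f x) = k%:E * \int[mu]_(x in D) f x.
Proof.
move=> f0 k0; rewrite integral_mkcond erestrict_scale [in RHS]integral_mkcond.
have fD0 x : 0 <= (f \_ D) x by exact: erestrict_ge0.
rewrite !ge0_integralTE// => [|x]; last by rewrite mule_ge0// lee_fin ltW.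
by rewrite -ereal_sup_pZl// -nnsfun_below_scale.
Qed.

End ge0_integral_nonmeasurable.

Section iterated_integral_positivity.
Variable R : realType.
Local Notation mu := (@lebesgue_measure R).

Lemma nbhs_itvcc (a b x : R) (U : set R) : a < b -> x \in `[a, b] ->
  nbhs x U -> exists c d, c < d /\ `[c, d] `<=` U `&` `[a, b].
Proof.
rewrite in_itv /= => ab /andP[ax xb] /nbhs_ballP[e /= e0 eU].
exists (Num.max a (x - e / 2)), (Num.min b (x + e / 2)); split.
  by rewrite gt_max !lt_min; lra.
move=> y /=; rewrite !in_itv /= ge_max le_min => hy; split; last by lra.
by apply: eU; rewrite /ball /= ltr_norml; lra.
Qed.

Lemma nbhs_integral_itv_ge (a b x : R) (U : set R) : a < b -> x \in `[a, b] ->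
  nbhs x U -> exists2 k : R, 0 < k & forall (g : R -> \bar R) (e : R),
    0 <= e -> (forall y, (0 <= g y)%E) -> (forall y, U y -> (e%:E <= g y)%E) ->
    ((e * k)%:E <= \int[mu]_(y in `[a, b]) g y)%E.
Proof.
move=> ab xab /(nbhs_itvcc ab xab)[c [d [cd cdU]]].
exists (d - c) => [|g e e0 g0 eg]; first by rewrite subr_gt0.
have <- : (e%:E * mu `[c, d] = (e * (d - c))%:E)%E.
  by rewrite lebesgue_measure_itv /= lte_fin cd.
by apply: ge0_integral_ge_cst => // y /cdU[]// /eg.
Qed.

Lemma near_integral_itv_ge (I : Type) (F : set_system I) {FF : Filter F}
    (g : I -> R -> \bar R) (a b x : R) : a < b -> x \in `[a, b] ->
  (forall i y, (0 <= g i y)%E) ->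
  (exists2 e : R, 0 < e & \forall i \near F & y \near x, (e%:E <= g i y)%E) ->
  exists2 e : R, 0 < e &
    \forall i \near F, (e%:E <= \int[mu]_(y in `[a, b]) g i y)%E.
Proof.
move=> ab xab g0 [e e0 [[V U] /= [FV xU] VUg]].
have [k k0 gk] := nbhs_integral_itv_ge ab xab xU.
exists (e * k); first exact: mulr_gt0.
apply: filterS FV => i Vi; apply: gk => //; first exact: ltW.
by move=> y Uy; apply: (VUg (i, y)).
Qed.

Lemma integral3_itv_gt0 (a b s t r : R) (F : R -> R -> R -> R) :
  a < b -> s \in `[a, b] -> t \in `[a, b] -> r \in `[a, b] ->
  (forall x y z, 0 <= F x y z) -> 0 < F s t r ->
  {for (s, t, r), continuous (fun v : R * R * R => F v.1.1 v.1.2 v.2)} ->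
  (0 < \int[mu]_(x in `[a, b]) \int[mu]_(y in `[a, b])
         \int[mu]_(z in `[a, b]) (F x y z)%:E)%E.
Proof.
move=> ab sab tab rab F_ge0 F_gt0 cF.
have F_ge0z (v : R * R) z : (0 <= (F v.1 v.2 z)%:E)%E by rewrite lee_fin.
have intz_ge0 x y : (0 <= \int[mu]_(z in `[a, b]) (F x y z)%:E)%E.
  by apply: integral_ge0 => z _; rewrite lee_fin.
have inty_ge0 x : (0 <= \int[mu]_(y in `[a, b])
    \int[mu]_(z in `[a, b]) (F x y z)%:E)%E.
  by apply: integral_ge0 => y _; exact: intz_ge0.
have near_F : exists2 e : R, 0 < e &
    \forall v \near (s, t) & z \near r, (e%:E <= (F v.1 v.2 z)%:E)%E.
  exists (F s t r / 2); first by rewrite divr_gt0.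
  have Fhalf : F s t r / 2 < F s t r by lra.
  by apply: filterS (cvgr_gt _ cF _ Fhalf) => v; rewrite lee_fin => /ltW.
have near_intz : exists2 e : R, 0 < e & \forall x \near s & y \near t,
    (e%:E <= \int[mu]_(z in `[a, b]) (F x y z)%:E)%E.
  exact: near_integral_itv_ge ab rab F_ge0z near_F.
have [e e0 near_inty] : exists2 e : R, 0 < e & \forall x \near s,
    (e%:E <= \int[mu]_(y in `[a, b]) \int[mu]_(z in `[a, b]) (F x y z)%:E)%E.
  exact: near_integral_itv_ge ab tab intz_ge0 near_intz.
have [k k0 int_ge] := nbhs_integral_itv_ge ab sab near_inty.
apply: lt_le_trans (int_ge _ e (ltW e0) inty_ge0 _) => //.
by rewrite lte_fin mulr_gt0.
Qed.

End iterated_integral_positivity.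

Lemma cvg_mx (K : numFieldType) (m n : nat) (T : Type) (F : set_system T)
    {FF : Filter F} (u : T -> 'M[K]_(m, n)) (A : 'M[K]_(m, n)) :
  u x @[x --> F] --> A <-> forall i j, u x i j @[x --> F] --> A i j.
Proof.
split=> [uA i j|uA].
  apply: (@continuous_cvg _ _ _ _ _ _ (fun M : 'M[K]_(m, n) => M i j)) => //.
  exact: coord_continuous.
apply/cvg_ballP => e e0.
have : \forall x \near F, forall ij : 'I_m * 'I_n,
    ball (A ij.1 ij.2) e (u x ij.1 ij.2).
  by apply: filter_forall => ij; exact: (cvg_ballP _ _).1 (uA _ _) _ e0.
apply: filterS => x Aux.
by split=> // i j; exact: (Aux (i, j)).
Qed.

Lemma periodic_antipodal (R : realType) (phi : R -> R) (T : R) : 0 <= T ->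
  continuous phi -> periodic phi T ->
  exists2 c, c \in `[0, T / 2] & phi (c + T / 2) = phi c.
Proof.
move=> T0 cphi perphi; pose g x := phi (x + T / 2) - phi x.
have gT2 : g (T / 2) = - g 0.
  by rewrite /g -splitr -[in phi T](add0r T) perphi add0r opprB.
have cg : continuous g.
  move=> x; apply: cvgB; last exact: cphi.
  apply: (@cvg_comp _ _ _ (fun y => y + T / 2) phi); last exact: cphi.
  by apply: cvgD; [exact: cvg_id|exact: cvg_cst].
have [|||c c0T gc0] := @IVT R g 0 (T / 2) 0.
- by rewrite divr_ge0.
- exact: continuous_subspaceT.
- by rewrite gT2 ge_min le_max oppr_le0 oppr_ge0 le_total orbC le_total.
- by exists c => //; apply: subr0_eq.
Qed.

Lemma is_derive_powRD1 (R : realType) (a : R) :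
  is_derive (0 : R) (1 : R) (fun x => (x + 1) `^ a) a.
Proof.
have powR_at1 : is_derive (shift 1 (0 : R)) 1 (fun x : R => x `^ a) a.
  have := @is_derive1_powR R a 1 ltr01.
  by rewrite powR1 mulr1 /shift/= add0r.
apply: is_derive_eq (is_derive1_comp powR_at1 (is_derive_shift 0 1 1)) _.
exact: mulr1.
Qed.

Section euclidean_norm_and_cross_product.
Variable R : realType.
Implicit Types (k : R) (u v : 'rV[R]_3).

Lemma enorm_ge0 v : 0 <= enorm v.
Proof. exact: sqrtr_ge0. Qed.

Lemma enorm_gt0 v : (0 < enorm v) = (v != 0).
Proof.
rewrite sqrtr_gt0 lt_def sumr_ge0 ?andbT; last by move=> i _; exact: sqr_ge0.
rewrite psumr_eq0; last by move=> i _; exact: sqr_ge0.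
congr (~~ _); apply/allP/eqP => [v0|-> i _]; last by rewrite /= mxE expr0n eqxx.
apply/rowP => i; rewrite mxE; apply/eqP.
by have := v0 i (mem_index_enum _); rewrite sqrf_eq0.
Qed.

Lemma enormZ k v : enorm (k *: v) = `|k| * enorm v.
Proof.
rewrite /enorm -sqrtr_sqr -sqrtrM ?sqr_ge0// mulr_sumr; congr Num.sqrt.
by apply: eq_bigr => i _; rewrite mxE exprMn.
Qed.

Lemma cross0v v : cross 0 v = 0.
Proof. by apply/rowP => i; rewrite !mxE !mul0r subrr. Qed.

Lemma crossv0 v : cross v 0 = 0.
Proof. by apply/rowP => i; rewrite !mxE !mulr0 subrr. Qed.

Lemma crossvv v : cross v v = 0.
Proof. by apply/rowP => i; rewrite !mxE mulrC subrr. Qed.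

Lemma crossZ k u v : cross (k *: u) (k *: v) = k ^+ 2 *: cross u v.
Proof. by apply/rowP => i; rewrite !mxE; ring. Qed.

Lemma cross_eq0_proportional u v i : cross u v = 0 -> u 0 i *: v = v 0 i *: u.
Proof.
move=> /rowP uv.
have swap (j : 'I_3) : u 0 (j + 1) * v 0 (j + 2) = v 0 (j + 1) * u 0 (j + 2).
  by apply: subr0_eq; have := uv j; rewrite !mxE [v 0 _ * _]mulrC.
have add21 : 2 + 1 = 0 :> 'I_3 by exact: val_inj.
have add12 : 1 + 2 = 0 :> 'I_3 by exact: val_inj.
have add22 : 2 + 2 = 1 :> 'I_3 by exact: val_inj.
apply/rowP => j; rewrite !mxE -[j](subrK i) addrC.
have [->|->|->] : [\/ j - i = 0, j - i = 1 | j - i = 2].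
  by case: (j - i) => [[|[|[|//]]]] ?;
    [apply: Or31|apply: Or32|apply: Or33]; exact: val_inj.
- by rewrite addr0 mulrC.
- by have := swap (i + 2); rewrite -!(addrA i) add21 add22 addr0.
- have := swap (i + 1); rewrite -!(addrA i) add12 addr0 => swap_i.
  by rewrite mulrC -swap_i mulrC.
Qed.

Section convergence.
Context (T : Type) (F : set_system T) {FF : Filter F}.
Implicit Types f g : T -> 'rV[R]_3.

Lemma cvg_enorm f u :
  f x @[x --> F] --> u -> enorm (f x) @[x --> F] --> enorm u.
Proof.
move=> /cvg_mx fu.
apply: (@continuous_cvg _ _ _ _ _ _ Num.sqrt); first exact: sqrt_continuous.
by apply: cvg_big => [|i _]; [exact: add_continuous|exact: cvgM].
Qed.

Lemma cvg_cross f g u v : f x @[x --> F] --> u -> g x @[x --> F] --> v ->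
  cross (f x) (g x) @[x --> F] --> cross u v.
Proof.
move=> /cvg_mx fu /cvg_mx gv; apply/cvg_mx => i j; rewrite mxE.
under eq_fun do rewrite mxE.
by apply: cvgB; apply: cvgM.
Qed.

End convergence.

End euclidean_norm_and_cross_product.

Lemma curve_space_periodic (R : realType) (p alpha : R) (f : R -> 'rV[R]_3) :
  curve_space p alpha f -> periodic f (2 * pi).
Proof. by rewrite /curve_space; case: ifP => _ [] // _ [g [[]]]. Qed.

Lemma C1_continuous (R : realType) (f : R -> 'rV[R]_3) : C1 f -> continuous f.
Proof.
move=> fC1 x; apply: differentiable_continuous; apply/derivable1_diffP.
exact: fC1.1.
Qed.

Section noncollinear_points.
Variable R : realType.
Implicit Types (a b c : 'rV[R]_3) (f : R -> 'rV[R]_3).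

Definition noncollinear a b c : bool := cross (b - a) (c - a) != 0.

Lemma noncollinear_neq a b c :
  noncollinear a b c -> [/\ a != b, a != c & b != c].
Proof.
move=> abc; split; apply: contraNneq abc => ->.
- by rewrite subrr cross0v.
- by rewrite subrr crossv0.
- by rewrite crossvv.
Qed.

Lemma simple_closed_antipodal f x : simple_closed f -> f (x + pi) != f x.
Proof.
move=> sf; apply/eqP; apply: sf => k /eqP.
have two_k : 1 != 2 * k%:~R :> R by rewrite -(intrM _ 2) (eqr_int _ 1); lia.
rewrite addrAC subrr add0r mulrAC -[X in X == _]mul1r.
by rewrite (inj_eq (mulIf (lt0r_neq0 (pi_gt0 R)))) (negPf two_k).
Qed.

Lemma simple_closed_noncollinear f :
  periodic f (2 * pi) -> continuous f -> simple_closed f ->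
  exists2 r, r \in `[0, 2 * pi] & noncollinear (f 0) (f pi) (f r).
Proof.
move=> fper fc fs; apply: contrapT => /forall2NP collinear.
have pi0 : 0 < pi :> R := pi_gt0 R.
have /rV0Pn[i ui0] : f pi - f 0 != 0.
  by rewrite subr_eq0 -[pi]add0r simple_closed_antipodal.
set u := f pi - f 0 in ui0.
have f_eq s t : s \in `[0, 2 * pi] -> t \in `[0, 2 * pi] ->
    f s 0 i = f t 0 i -> f s = f t.
  move=> sP tP st; apply: (addIr (- f 0)); apply: (scalerI ui0).
  have on_line r : r \in `[0, 2 * pi] ->
      u 0 i *: (f r - f 0) = (f r - f 0) 0 i *: u.
    move=> rP; apply: cross_eq0_proportional; apply: contrapT => /eqP.
    by have [] := collinear r.
  by rewrite !on_line// !mxE st.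
have [|x|x|c] := @periodic_antipodal R (fun x => f x 0 i) (2 * pi).
- by rewrite mulr_ge0// ltW.
- by have /cvg_mx := fc x; apply.
- by rewrite fper.
rewrite [2 * pi]mulrC mulfK// in_itv /= => cP /f_eq fcpi.
have := simple_closed_antipodal c fs.
by rewrite fcpi ?eqxx// in_itv /=; lra.
Qed.

End noncollinear_points.

Section menger_integrand.
Variable R : realType.
Implicit Types (p : R) (f : R -> 'rV[R]_3).

Definition menger_integrand p f (s t r : R) : R :=
  menger_curvature f s t r `^ p *
  enorm (derive1 f s) * enorm (derive1 f t) * enorm (derive1 f r).

Lemma menger_curvature_ge0 f s t r : 0 <= menger_curvature f s t r.
Proof. by rewrite divr_ge0 ?mulr_ge0 ?enorm_ge0. Qed.

Lemma menger_integrand_ge0 p f s t r : 0 <= menger_integrand p f s t r.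
Proof. by rewrite !mulr_ge0 ?powR_ge0 ?enorm_ge0. Qed.

Lemma menger_chords_gt0 f s t r : noncollinear (f s) (f t) (f r) ->
  0 < enorm (f t - f s) * enorm (f s - f r) * enorm (f r - f t).
Proof.
move=> /noncollinear_neq[st sr tr].
by rewrite !mulr_gt0 ?enorm_gt0 ?subr_eq0// eq_sym.
Qed.

Lemma menger_curvature_gt0 f s t r :
  noncollinear (f s) (f t) (f r) -> 0 < menger_curvature f s t r.
Proof.
by move=> str; rewrite divr_gt0 ?menger_chords_gt0// mulr_gt0// enorm_gt0.
Qed.

Lemma menger_integrand_gt0 p f s t r : (forall x, derive1 f x <> 0) ->
  noncollinear (f s) (f t) (f r) -> 0 < menger_integrand p f s t r.
Proof.
move=> f'0 str.
by rewrite !mulr_gt0 ?powR_gt0 ?menger_curvature_gt0// enorm_gt0; exact/eqP.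
Qed.

Section convergence.
Context (T : Type) (F : set_system T) {FF : Filter F}.
Variables (f : R -> 'rV[R]_3) (s t r : T -> R) (s0 t0 r0 : R).
Hypothesis cvg_s : s x @[x --> F] --> s0.
Hypothesis cvg_t : t x @[x --> F] --> t0.
Hypothesis cvg_r : r x @[x --> F] --> r0.
Hypothesis cf : continuous f.
Hypothesis str0 : noncollinear (f s0) (f t0) (f r0).

Lemma cvg_menger_curvature :
  menger_curvature f (s x) (t x) (r x) @[x --> F] -->
  menger_curvature f s0 t0 r0.
Proof.
have cvg_f (y : T -> R) y0 :
    y x @[x --> F] --> y0 -> f (y x) @[x --> F] --> f y0.
  by move=> yy0; apply: (@continuous_cvg _ _ _ _ _ _ f) => //; exact: cf.
have cvg_chord (y z : T -> R) y0 z0 : y x @[x --> F] --> y0 ->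
    z x @[x --> F] --> z0 -> f (y x) - f (z x) @[x --> F] --> f y0 - f z0.
  by move=> yy0 zz0; apply: cvgB; exact: cvg_f.
apply: cvgM; last first.
  apply: cvgV; first by rewrite gt_eqF// menger_chords_gt0.
  by apply: cvgM; [apply: cvgM|]; apply: cvg_enorm; exact: cvg_chord.
by apply: cvgMr; apply: cvg_enorm; apply: cvg_cross; exact: cvg_chord.
Qed.

Lemma cvg_menger_integrand p : continuous (derive1 f) ->
  menger_integrand p f (s x) (t x) (r x) @[x --> F] -->
  menger_integrand p f s0 t0 r0.
Proof.
move=> cf'.
have cvg_speed (y : T -> R) y0 : y x @[x --> F] --> y0 ->
    enorm (derive1 f (y x)) @[x --> F] --> enorm (derive1 f y0).
  move=> yy0; apply: cvg_enorm.
  by apply: (@continuous_cvg _ _ _ _ _ _ (derive1 f)) => //; exact: cf'.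
apply: cvgM; [apply: cvgM; [apply: cvgM|]|]; try exact: cvg_speed.
apply: (@continuous_cvg _ _ _ _ _ _ (fun x => x `^ p)).
  apply: differentiable_continuous; apply/derivable1_diffP.
  by apply: derivable_powR; rewrite in_itv /= menger_curvature_gt0.
exact: cvg_menger_curvature.
Qed.

End convergence.

End menger_integrand.

Lemma menger_energy_gt0 (R : realType) (p : R) (f : R -> 'rV[R]_3) :
  periodic f (2 * pi) -> simple_closed f -> regular f ->
  (0 < menger_energy p f)%E.
Proof.
move=> fper fs [fC1 f'0]; have pi0 : 0 < pi :> R := pi_gt0 R.
have [r rP f0pir] := simple_closed_noncollinear fper (C1_continuous fC1) fs.
apply: (@integral3_itv_gt0 _ 0 (2 * pi) 0 pi r (menger_integrand p f)) => //.
- by rewrite mulr_gt0.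
- by rewrite in_itv /=; lra.
- by rewrite in_itv /=; lra.
- exact: menger_integrand_ge0.
- exact: menger_integrand_gt0.
apply: cvg_menger_integrand => //.
- by apply: (@cvg_comp _ _ _ fst fst); exact: cvg_fst.
- by apply: (@cvg_comp _ _ _ fst snd); [exact: cvg_fst|exact: cvg_snd].
- exact: cvg_snd.
- exact: C1_continuous.
- exact: fC1.2.
Qed.

Section homogeneity.
Variable R : realType.
Implicit Types (p k d : R) (f Phi : R -> 'rV[R]_3).

Lemma menger_curvatureZ f k s t r :
  menger_curvature (fun x => k *: f x) s t r =
  `|k|^-1 * menger_curvature f s t r.
Proof.
have norm_k : `|k| ^+ 2 / `|k| ^+ 3 = `|k|^-1.
  by have [->|k0] := eqVneq `|k| 0; [rewrite invr0 expr0n mul0r|field].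
rewrite /menger_curvature -!scalerBr crossZ !enormZ normrX -norm_k.
set chords := enorm (f t - f s) * _ * _.
have -> : `|k| * enorm (f t - f s) * (`|k| * enorm (f s - f r)) *
  (`|k| * enorm (f r - f t)) = `|k| ^+ 3 * chords by rewrite /chords; ring.
by rewrite invfM; ring.
Qed.

Lemma menger_integrandZ p f k s t r : (forall x, derivable f x 1) -> k != 0 ->
  menger_integrand p (fun x => k *: f x) s t r =
  `|k| `^ (3 - p) * menger_integrand p f s t r.
Proof.
move=> df k0; have k_gt0 : 0 < `|k| by rewrite normr_gt0.
have speedZ x :
    enorm (derive1 (fun y => k *: f y) x) = `|k| * enorm (derive1 f x).
  by rewrite -enormZ !derive1E deriveZ.
transitivity ((`|k|^-1 * menger_curvature f s t r) `^ p *
    (`|k| * enorm (derive1 f s)) * (`|k| * enorm (derive1 f t)) *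
    (`|k| * enorm (derive1 f r))).
  congr (_ `^ p * _ * _ * _); first exact: menger_curvatureZ.
  - exact: speedZ.
  - exact: speedZ.
  - exact: speedZ.
have -> : `|k| `^ (3 - p) = `|k|^-1 `^ p * `|k| ^+ 3.
  rewrite powRB ?(gt_eqF k_gt0) ?implybT// (powR_mulrn 3)// mulrC.
  by rewrite -(powR_inv1 (ltW k_gt0)) -powRrM mulN1r powRN.
rewrite powRM ?invr_ge0 ?menger_curvature_ge0// /menger_integrand.
have regroup (a b c x y z : R) :
  a * c * (b * x) * (b * y) * (b * z) = a * b ^+ 3 * (c * x * y * z) by ring.
exact: regroup.
Qed.

Lemma menger_energyZ p f k : (forall x, derivable f x 1) -> k != 0 ->
  menger_energy p (fun x => k *: f x) =
  ((`|k| `^ (3 - p))%:E * menger_energy p f)%E.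
Proof.
move=> df k0; have K0 : 0 < `|k| `^ (3 - p) by rewrite powR_gt0// normr_gt0.
have integrand_ge0 s t r : (0 <= (menger_integrand p f s t r)%:E)%E.
  by rewrite lee_fin menger_integrand_ge0.
rewrite /menger_energy -ge0_integralZl_nonmeasurable// => [|s _]; last first.
  by do 2!apply: integral_ge0 => ? _; exact: integrand_ge0.
apply: eq_integral => s _; rewrite -ge0_integralZl_nonmeasurable// => [|t _].
  apply: eq_integral => t _; rewrite -ge0_integralZl_nonmeasurable//.
    by apply: eq_integral => r _; congr _%:E; exact: menger_integrandZ.
  by move=> r _; exact: integrand_ge0.
by apply: integral_ge0 => r _; exact: integrand_ge0.
Qed.

Lemma first_variation_fin_num p f Phi d :
  is_first_variation p f Phi d -> menger_energy p f \is a fin_num.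
Proof.
move=> [/nbhs_singleton + _].
by under eq_fun do rewrite scale0r addr0.
Qed.

Lemma first_variation_unique p f Phi d1 d2 :
  is_first_variation p f Phi d1 -> is_first_variation p f Phi d2 -> d1 = d2.
Proof.
move=> [_ d1P] [_ d2P].
by rewrite -(derive_val (is_derive := d1P)) (derive_val (is_derive := d2P)).
Qed.

Lemma first_variation_self p f : (forall x, derivable f x 1) ->
  menger_energy p f \is a fin_num ->
  is_first_variation p f f ((3 - p) * fine (menger_energy p f)).
Proof.
move=> df finE; set E0 := menger_energy p f.
have near_EZ : \forall tau \near (0 : R),
    menger_energy p (fun x => f x + tau *: f x) =
    (((tau + 1) `^ (3 - p))%:E * E0)%E.
  have : \forall tau \near (0 : R), -1 < tau by apply: lt_nbhsr; rewrite ltrN10.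
  apply: filterS => tau tau1; have tau1_gt0 : 0 < tau + 1 by lra.
  have -> : (fun x => f x + tau *: f x) = (fun x => (tau + 1) *: f x).
    by apply/funext => x; rewrite scalerDl scale1r addrC.
  by rewrite menger_energyZ ?gt_eqF// gtr0_norm.
split; first by apply: filterS near_EZ => tau ->; rewrite fin_numM.
apply: (@near_eq_is_derive _ _ _ (fine E0 \*: fun tau => (tau + 1) `^ (3 - p))).
  by apply: filterS near_EZ => tau ->; rewrite fineM// mulrC.
by rewrite mulrC; apply: is_deriveZ; exact: is_derive_powRD1.
Qed.

End homogeneity.

Theorem mainTheorem5 (R : realType) (p alpha : R)
    (p_ge2 : 2 <= p) (p_neq3 : p <> 3)
    (alphaP : p < 3 -> 1 - 2 / p < alpha <= 1) :
  (forall gamma : R -> 'rV[R]_3,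
     curve_space p alpha gamma -> simple_closed gamma -> regular gamma ->
     (0 < menger_energy p gamma)%E) /\
  ~ (exists gamma : R -> 'rV[R]_3,
       [/\ curve_space p alpha gamma, simple_closed gamma, regular gamma &
           forall Phi : R -> 'rV[R]_3, curve_space p alpha Phi ->
             is_first_variation p gamma Phi 0]).
Proof.
have energy_gt0 gamma : curve_space p alpha gamma -> simple_closed gamma ->
    regular gamma -> (0 < menger_energy p gamma)%E.
  by move=> /curve_space_periodic; exact: menger_energy_gt0.
split=> // -[gamma [gammaX gamma_simple gamma_reg stationary]].
have deltaE0 := stationary gamma gammaX.
have finE := first_variation_fin_num deltaE0.
have deltaE := first_variation_self gamma_reg.1.1 finE.
have /esym/eqP := first_variation_unique deltaE0 deltaE.
have E_gt0 : 0 < fine (menger_energy p gamma).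
  by rewrite fine_gt0// energy_gt0//= ltey_eq finE.
by rewrite mulf_eq0 (gt_eqF E_gt0) orbF subr_eq0 => /eqP /esym.
Qed.
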